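(* Let $(\mathcal{M},\star)$ be a unique factorisation normed magma whose set of irreducible elements $\mathcal{M}^0$ is non-empty and finite. Then $(\mathcal{M},\star)$ is a free magma generated by its irreducible elements, i.e. by $\mathcal{M}^0$.
   Context: Here $\mathbb{N}=\{1,2,3,\dots\}$. A magma $(\mathcal{M},\star)$ is a non-empty countable set $\mathcal{M}$ (the base set) together with a map $\star:\mathcal{M}\times\mathcal{M}\to\mathcal{M}$ (no further conditions). A magma morphism $\theta:(\mathcal{M},\star)\to(\mathcal{N},\bullet)$ is a map with $\theta(m\star m')=\theta(m)\bullet\theta(m')$ for all $m,m'\in\mathcal{M}$. The range of the map $\star$ is denoted $\mathcal{M}^+$ (reducible elements); the elements of $\mathcal{M}^0=\mathcal{M}\setminus\mathcal{M}^+$ are the irreducible elements. The magma is a unique factorisation magma if the product map $\star:\mathcal{M}\times\mathcal{M}\to\mathcal{M}$ is injective. A norm on $(\mathcal{M},\star)$ is a map $\|\cdot\|:\mathcal{M}\to\mathbb{N}$ that is super-additive: $\|m_1\star m_2\|\ge\|m_1\|+\|m_2\|$ for all $m_1,m_2\in\mathcal{M}$. A normed magma is a magma that has a norm. A magma $(\mathcal{M},\star)$ is free if there exist a set $\mathcal{Y}$ and a map $i:\mathcal{Y}\to\mathcal{M}$ such that for every magma $(\mathcal{N},\bullet)$ and every map $f:\mathcal{Y}\to\mathcal{N}$ there is a unique magma morphism $\theta:\mathcal{M}\to\mathcal{N}$ with $f=\theta\circ i$. The image $i(\mathcal{Y})\subseteq\mathcal{M}$ is called the set of generators of $\mathcal{M}$,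 and $\mathcal{M}$ is said to be generated by $i(\mathcal{Y})$. *)

(* Defs.v *)
From HB Require Import structures.
From mathcomp Require Import all_boot.
From mathcomp Require Import boolp classical_sets functions cardinality.

Set Implicit Arguments.
Unset Strict Implicit.
Unset Printing Implicit Defensive.

Local Open Scope classical_set_scope.

(* A [magmaType] is a bare type with a binary operation; the base set of a
   magma is moreover required to be non-empty and (at most) countable. *)
Definition is_magma (M : magmaType) : Prop :=
  [set: M] !=set0 /\ countable [set: M].

Definition product_map (M : magmaType) (p : M * M) : M := (p.1 * p.2)%g.

Definition reducible (M : magmaType) : set M := range (@product_map M).
Arguments reducible : clear implicits.

Definition irreducible (M : magmaType) : set M := ~` reducible M.
Arguments irreducible : clear implicits.

Definition unique_factorisation (M : magmaType) : Prop :=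
  injective (@product_map M).

(* The values of a norm lie in {1, 2, 3, ...}. *)
Definition is_norm (M : magmaType) (norm : M -> nat) : Prop :=
  (forall m, 0 < norm m) /\
  (forall m1 m2, norm m1 + norm m2 <= norm (m1 * m2)%g).

Definition normed (M : magmaType) : Prop := exists norm, @is_norm M norm.

Definition free_via (M : magmaType) (Y : Type) (i : Y -> M) : Prop :=
  forall N : magmaType, is_magma N -> forall f : Y -> N,
    exists! theta : {multiplicative M -> N}, f = theta \o i.

Definition free_generated_by (M : magmaType) (G : set M) : Prop :=
  exists (Y : Type) (i : Y -> M), free_via i /\ range i = G.

(* Main.v *)
(* Super-additivity and positivity make both factors of a product strictly
   smaller in norm than the product. Hence the recursion
   [theta (a * b) = theta a * theta b], [theta = f] on irreducibles, terminates,
   unique factorisation makes it well defined, and strong induction on the norm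
   shows that irreducible elements determine a morphism. *)
Require Import Defs.
From HB Require Import structures.
From mathcomp Require Import all_boot.
From mathcomp Require Import boolp classical_sets functions cardinality.

Local Open Scope classical_set_scope.

Lemma norm_ltMl {M : magmaType} {norm : M -> nat} (a b : M) :
  is_norm norm -> norm a < norm (a * b)%g.
Proof.
move=> [norm_gt0 normM]; apply: leq_trans (normM a b).
by rewrite -addn1 leq_add2l.
Qed.

Lemma norm_ltMr {M : magmaType} {norm : M -> nat} (a b : M) :
  is_norm norm -> norm b < norm (a * b)%g.
Proof.
move=> [norm_gt0 normM]; apply: leq_trans (normM a b).
by rewrite -add1n leq_add2r.
Qed.

Lemma normed_magma_ind (M : magmaType) (P : M -> Prop) :
  normed M -> (forall m, irreducible M m -> P m) ->
  (forall a b, P a -> P b -> P (a * b)%g) -> forall m, P m.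
Proof.
move=> [norm norm_spec] P_irr PM m.
(* Inducting on a bound [k] for the norm, with [m] general, makes the hypothesis available for both
   factors. *)
have [k] := ubnP (norm m); elim: k m => // k IHk m lt_mk.
have [[[a b] _ abE]|m_irr] := EM (reducible M m); last exact: P_irr.
rewrite -{}abE /product_map /= ltnS in lt_mk *; apply: PM; apply: IHk.
  exact: leq_trans (norm_ltMl a b norm_spec) lt_mk.
exact: leq_trans (norm_ltMr a b norm_spec) lt_mk.
Qed.

(** Uniqueness in [free_via] concerns packed morphisms, so their proofs of multiplicativity must
    agree too; proof irrelevance identifies them. *)
Lemma multiplicative_ext (M N : magmaType) (g h : {multiplicative M -> N}) :
  (forall m, g m = h m) -> g = h.
Proof.
move=> /funext; case: g h => [g [[gM]]] [h [[hM]]] /= gh.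
by case: h / gh hM => hM; rewrite (Prop_irrelevance gM hM).
Qed.

Section Extension.
Context {M N : magmaType} (f : {m : M | irreducible M m} -> N).

(** The pair is picked by classical choice; it is canonical only under unique factorisation. *)
Definition factors {m : M} (m_red : reducible M m) : M * M :=
  s2val (cid2 m_red).

Lemma factorsK {m} (m_red : reducible M m) : product_map (factors m_red) = m.
Proof. exact: s2valP' (cid2 m_red). Qed.

(* Only the values with [norm m <= k] are meaningful; [n0] is returned when the
   fuel [k] runs out. *)
Fixpoint extend_fuel (n0 : N) (k : nat) (m : M) : N :=
  if k is k'.+1 then
    match pselect (reducible M m) with
    | left m_red => (extend_fuel n0 k' (factors m_red).1 *
                     extend_fuel n0 k' (factors m_red).2)%g
    | right m_irr => f (exist _ m m_irr)
    end
  else n0.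

Lemma extend_fuel_irr n0 k {m} (m_irr : irreducible M m) :
  0 < k -> extend_fuel n0 k m = f (exist _ m m_irr).
Proof.
case: k => //= k _; case: pselect => [/m_irr//|m_irr'].
by rewrite (Prop_irrelevance m_irr' m_irr).
Qed.

Lemma extend_fuelM n0 k a b : unique_factorisation M ->
  extend_fuel n0 k.+1 (a * b)%g =
  (extend_fuel n0 k a * extend_fuel n0 k b)%g.
Proof.
move=> fact /=; case: pselect => [ab_red|]; last by case; exists (a, b).
by have -> : factors ab_red = (a, b) by apply: fact; exact: factorsK.
Qed.

(** A recursive call costs one unit of fuel, but the norm also drops by at least one, so fuel that
    suffices at first keeps sufficing. *)
Lemma extend_fuel_stable norm n0 k m :
  unique_factorisation M -> is_norm norm -> norm m <= k ->
  extend_fuel n0 k m = extend_fuel n0 (norm m) m.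
Proof.
move=> fact norm_spec; have [norm_gt0 _] := norm_spec.
(* Two arbitrary sufficient amounts are compared, so that the induction hypothesis applies to their
   predecessors at the factors. *)
suff stable j l : norm m <= j -> norm m <= l ->
    extend_fuel n0 j m = extend_fuel n0 l m by move=> ?; apply: stable.
move: m j l; apply: normed_magma_ind; first by exists norm.
  move=> m m_irr j l lej lel.
  by rewrite !(extend_fuel_irr _ _ m_irr) // (leq_trans (norm_gt0 m)).
move=> a b IHa IHb j l lej lel.
have lta := norm_ltMl a b norm_spec; have ltb := norm_ltMr a b norm_spec.
have := leq_trans ltb lel; have := leq_trans ltb lej.
have := leq_trans lta lel; have := leq_trans lta lej.
case: j l {lej lel} => // j [|l] // aj al bj bl.
by rewrite !extend_fuelM // (IHa j l) // (IHb j l).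
Qed.

Lemma extension_exists : unique_factorisation M -> normed M -> [set: N] !=set0 ->
  exists theta : {multiplicative M -> N}, f = theta \o sval.
Proof.
move=> fact [norm norm_spec] [n0 _]; have [norm_gt0 _] := norm_spec.
(* Fuel [norm m] is positive and never runs out, so the default [n0] is never returned. *)
pose theta m := extend_fuel n0 (norm m) m.
have thetaM : {morph theta : a b / (a * b)%g}.
  move=> a b; have lta := norm_ltMl a b norm_spec.
  have ltb := norm_ltMr a b norm_spec; rewrite /theta.
  (* With [norm (a * b)] equal to [k.+1], the factors receive fuel [k], which is at least their
     norms; stability trades it for [norm a] and [norm b]. *)
  case: (norm (a * b)%g) lta ltb => // k lea leb.
  by rewrite extend_fuelM // !(extend_fuel_stable norm).
pose thetaB := isMultiplicative.Build M N theta thetaM.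
pose thetaH : {multiplicative M -> N} := HB.pack theta thetaB.
exists thetaH; apply/funext => -[m m_irr] /=.
by rewrite /theta (extend_fuel_irr _ _ m_irr).
Qed.

End Extension.

Theorem theorem1 (M : magmaType) (hM : is_magma M)
    (hfact : unique_factorisation M) (hnormed : normed M)
    (hirr0 : irreducible M !=set0) (hirrfin : finite_set (irreducible M)) :
  free_generated_by (irreducible M).
Proof.
exists {m : M | irreducible M m}, sval; split; last first.
  apply/seteqP; split=> [_ [[m m_irr] _ <-] //|m m_irr].
  by exists (exist _ m m_irr).
move=> N [N0 _] f; have [theta thetaE] := extension_exists f hfact hnormed N0.
exists theta; split=> // theta' theta'E; apply: multiplicative_ext.
apply: normed_magma_ind => // [m m_irr|a b IHa IHb].
  (* Both morphisms restrict to [f]; evaluating at the generator [m] compares them there. *)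
  have := congr1 (@^~ (exist _ m m_irr)) theta'E.
  by rewrite [in X in X -> _]thetaE.
by rewrite !gmulfM IHa IHb.
Qed.
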